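(* Consider the leader $v(t+1)=Sv(t)$ and the followers $x_i(t+1)=A_ix_i(t)+B_iu_i(t)+E_iv(t)$, $e_i(t)=C_ix_i(t)+D_iu_i(t)+F_iv(t)$, $y_{mi}(t)=C_{mi}x_i(t)+D_{mi}u_i(t)+F_{mi}v(t)$, $i=1,\dots,N$, with communication graph $\bar{\mathcal G}$, as in the context. Assume: (1) all eigenvalues of $S$ have modulus smaller than or equal to $1$; (2) for $i=1,\dots,N$, the pair $(A_i,B_i)$ is stabilizable; (3) for $i=1,\dots,N$, the pair $(C_{mi},A_i)$ is detectable; (4) for $i=1,\dots,N$, the linear matrix equations $X_iS=A_iX_i+B_iU_i+E_i$, $0=C_iX_i+D_iU_i+F_i$ have a unique solution pair $(X_i,U_i)$, $X_i\in\mathbb R^{n_i\times q}$, $U_i\in\mathbb R^{m_i\times q}$; (5) $\bar{\mathcal G}$ contains a spanning tree with node $0$ as the root. Let $0<\mu_1<\frac{2}{\rho(H)}$, let $\mu_2>0$ be such that $(I_N\otimes S)-\mu_2(H\otimes S)$ is Schur, and let $0<\mu_{3i}<\frac{2}{\rho(Q_i^TQ_i)}$, $i=1,\dots,N$. For each $i$ let $K_{xi}\in\mathbb R^{m_i\times n_i}$ be such that $A_i+B_iK_{xi}$ is Schur and let $L_i\in\mathbb R^{n_i\times p_{mi}}$ be such that $A_i+L_iC_{mi}$ is Schur. Consider the control law, for $i=1,\dots,N$, $$u_i(t)=K_{xi}\xi_i(t)+K_{\eta i}(t)\eta_i(t),\qquad K_{\eta i}(t)=\hat U_i(t)-K_{xi}\hat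 X_i(t),$$ $$\xi_i(t+1)=A_i\xi_i(t)+B_iu_i(t)+E_i\eta_i(t)+L_i\big(C_{mi}\xi_i(t)+D_{mi}u_i(t)+F_{mi}\eta_i(t)-y_{mi}(t)\big),$$ $$S_i(t+1)=S_i(t)+\mu_1\sum_{j=0}^Na_{ij}(S_j(t)-S_i(t)),$$ $$\eta_i(t+1)=S_i(t)\eta_i(t)+\mu_2S_i(t)\sum_{j=0}^Na_{ij}(\eta_j(t)-\eta_i(t)),$$ $$\zeta_i(t+1)=\zeta_i(t)-\mu_{3i}G_i(t)^T(G_i(t)\zeta_i(t)-b_i),$$ where $S_0(t)=S$, $\eta_0(t)=v(t)$, and $\begin{bmatrix}\hat X_i(t)\\ \hat U_i(t)\end{bmatrix}=M^q_{n_i+m_i}(\zeta_i(t))$ with $\hat X_i(t)\in\mathbb R^{n_i\times q}$, $\hat U_i(t)\in\mathbb R^{m_i\times q}$. Then the trajectory of the closed-loop system starting from any initial state ($v(0)$, $x_i(0)$, $\xi_i(0)$, $S_i(0)$, $\eta_i(0)$, $\zeta_i(0)$, $i=1,\dots,N$) exists for all $t\ge 0$ and satisfies: (a) when $v$ is bounded, the trajectory of the closed-loop system is bounded for all $t\ge0$; (b) $\lim_{t\to\infty}e_i(t)=0$ for $i=1,\dots,N$.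
   Context: Time $t$ ranges over the nonnegative integers. A square matrix is Schur if all its eigenvalues have modulus less than $1$. For a square matrix $A$ with spectrum $\sigma(A)$, $\rho(A)=\max_{\lambda\in\sigma(A)}\frac{|\lambda|^2}{\mathrm{Re}(\lambda)}$ (this is not the spectral radius in general). $\otimes$ is the Kronecker product. $\mathrm{vec}(A)$ is the column vector obtained by stacking the columns of $A$; for $X=\mathrm{col}(X_1,\dots,X_q)\in\mathbb R^{nq}$ with $X_k\in\mathbb R^n$, $M^q_n(X)=[X_1\ \cdots\ X_q]\in\mathbb R^{n\times q}$. Dimensions: $v\in\mathbb R^q$ (leader state), $S\in\mathbb R^{q\times q}$, $x_i\in\mathbb R^{n_i}$ (state), $u_i\in\mathbb R^{m_i}$ (input), $e_i\in\mathbb R^{m_i}$ (regulated output), $y_{mi}\in\mathbb R^{p_{mi}}$ (measurement output), and $A_i,B_i,C_i,D_i,E_i,F_i,C_{mi},D_{mi},F_{mi}$ are constant real matrices of compatible dimensions. Also $S_i\in\mathbb R^{q\times q}$, $\eta_i\in\mathbb R^q$, $\xi_i\in\mathbb R^{n_i}$, $\zeta_i\in\mathbb R^{q(n_i+m_i)}$. Graph: $\bar{\mathcal G}=(\bar{\mathcal V},\bar{\mathcal E})$ is a directed graph with $\bar{\mathcal V}=\{0,1,\dots,N\}$; node $0$ is the leader, node $i$ the $i$th follower; for $i=0,\dots,N$, $j=1,\dots,N$, $(i,j)\in\bar{\mathcal E}$ means agent $j$ can use information of agent $i$. $[a_{ij}]_{i,j=0}^N$ is a weighted adjacency matrix of $\bar{\mathcal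 G}$: $a_{ii}=0$, $a_{ij}>0$ if $(j,i)\in\bar{\mathcal E}$, and $a_{ij}=0$ otherwise. Thus the control law of follower $i$ uses only information of agent $i$ and its neighbors, i.e. it is distributed. A spanning tree rooted at $0$ means that every other node is reachable from $0$ by a directed path. $H=[h_{ij}]\in\mathbb R^{N\times N}$ ($i,j=1,\dots,N$) with $h_{ii}=\sum_{j=0}^Na_{ij}$ and $h_{ij}=-a_{ij}$ for $i\ne j$. For $i=1,\dots,N$: $$b_i=\mathrm{vec}\begin{bmatrix}E_i \\ F_i\end{bmatrix},\quad Q_i=S^T\otimes\begin{bmatrix}I_{n_i}&0 \\ 0&0\end{bmatrix}-I_q\otimes\begin{bmatrix}A_i&B_i \\ C_i&D_i\end{bmatrix},\quad G_i(t)=S_i(t)^T\otimes\begin{bmatrix}I_{n_i}&0 \\ 0&0\end{bmatrix}-I_q\otimes\begin{bmatrix}A_i&B_i \\ C_i&D_i\end{bmatrix}.$$ *)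

(* Defs.v *)
From HB Require Import structures.
From mathcomp Require Import all_boot all_order all_algebra.
From mathcomp Require Import all_classical all_reals all_analysis.
From mathcomp Require Import complex mxtens.

Set Implicit Arguments.
Unset Strict Implicit.
Unset Printing Implicit Defensive.

Import Order.TTheory GRing.Theory Num.Theory.
Import numFieldNormedType.Exports.

Local Open Scope classical_set_scope.
Local Open Scope ring_scope.

Section Spectra.
Variables (R : realType).

(* The spectrum of a real matrix is taken over the complex numbers. *)
Definition spectrum n (A : 'M[R]_n) : set (complex R) :=
  [set l | eigenvalue (map_mx (real_complex R) A) l].

Definition schur n (A : 'M[R]_n) : Prop :=
  forall l, spectrum A l -> Normc.normc l < 1.

(* The spectrum is finite, so the supremum is the maximum as soon as A has a  *)
(* positive size. For the empty matrix it is 0, and then 2 / rho A = 0.       *)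
Definition rho n (A : 'M[R]_n) : R :=
  sup [set Normc.normc l ^+ 2 / complex.Re l | l in spectrum A].

Definition stabilizable n m (A : 'M[R]_n) (B : 'M[R]_(n, m)) : Prop :=
  exists K : 'M[R]_(m, n), schur (A + B *m K).

Definition detectable n p (C : 'M[R]_(p, n)) (A : 'M[R]_n) : Prop :=
  exists L : 'M[R]_(n, p), schur (A + L *m C).

(* mxtens_index (k, i) has value k * n + i: vec stacks the columns of A, and  *)
(* the k-th column of unvec X is the k-th block of length n of X.             *)
Definition vec n q (A : 'M[R]_(n, q)) : 'cV[R]_(q * n) :=
  \col_k A (mxtens_unindex k).2 (mxtens_unindex k).1.

Definition unvec n q (X : 'cV[R]_(q * n)) : 'M[R]_(n, q) :=
  \matrix_(i, k) X (mxtens_index (k, i)) 0.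

End Spectra.

Section Graph.
Variables (R : realType) (N : nat).

(* Nodes are 'I_N.+1: ord0 is the leader, lift ord0 i is the follower i.      *)

(* E i j is the edge from i to j, which carries the weight a j i. *)
Definition weighted_adjacency (E : rel 'I_N.+1) (a : 'M[R]_N.+1) : Prop :=
  (forall i, a i i = 0) /\
  (forall i j, (E j i -> 0 < a i j) /\ (~~ E j i -> a i j = 0)).

Definition spanning_tree_from0 (E : rel 'I_N.+1) : Prop :=
  forall i, connect E ord0 i.

Definition Hmx (a : 'M[R]_N.+1) : 'M[R]_N :=
  \matrix_(i, j) if i == j then \sum_k a (lift ord0 i) k
                 else - a (lift ord0 i) (lift ord0 j).

(* The family indexed by all nodes that is z0 at the leader. *)
Definition with_leader T (z0 : T) (z : 'I_N -> T) (k : 'I_N.+1) : T :=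
  if unlift ord0 k is Some i then z i else z0.

Definition consensus n q (a : 'M[R]_N.+1)
    (z0 : 'M[R]_(n, q)) (z : 'I_N -> 'M[R]_(n, q)) (i : 'I_N) : 'M[R]_(n, q) :=
  \sum_j a (lift ord0 i) j *: (with_leader z0 z j - z i).

End Graph.

(* The input u and the regulated output e have the same dimension. *)
Record follower (R : realType) (q : nat) := Follower {
  dimx : nat;
  dimu : nat;
  dimy : nat;
  fA : 'M[R]_dimx;
  fB : 'M[R]_(dimx, dimu);
  fC : 'M[R]_(dimu, dimx);
  fD : 'M[R]_dimu;
  fE : 'M[R]_(dimx, q);
  fF : 'M[R]_(dimu, q);
  fCm : 'M[R]_(dimy, dimx);
  fDm : 'M[R]_(dimy, dimu);
  fFm : 'M[R]_(dimy, q)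
}.

Section RegulatorEquations.
Variables (R : realType) (q : nat).

Definition regulator_equations (f : follower R q) (S : 'M[R]_q)
    (X : 'M[R]_(dimx f, q)) (U : 'M[R]_(dimu f, q)) : Prop :=
  X *m S = fA f *m X + fB f *m U + fE f /\
  0 = fC f *m X + fD f *m U + fF f.

Definition bvec (f : follower R q) : 'cV[R]_(q * (dimx f + dimu f)) :=
  vec (col_mx (fE f) (fF f)).

(* Q_i is Qmx at S, and G_i(t) is Qmx at S_i(t). *)
Definition Qmx (f : follower R q) (S : 'M[R]_q) :
    'M[R]_(q * (dimx f + dimu f)) :=
  S^T *t block_mx (1%:M : 'M[R]_(dimx f)) 0 0 (0 : 'M[R]_(dimu f))
  - (1%:M : 'M[R]_q) *t block_mx (fA f) (fB f) (fC f) (fD f).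

End RegulatorEquations.

Section ClosedLoop.
Variables (R : realType) (q N : nat).
Variables (S : 'M[R]_q) (F : 'I_N -> follower R q) (a : 'M[R]_N.+1).
Variables (mu1 mu2 : R) (mu3 : 'I_N -> R).
Variables (Kx : forall i, 'M[R]_(dimu (F i), dimx (F i)))
          (L : forall i, 'M[R]_(dimx (F i), dimy (F i))).

Record state := State {
  st_v : 'cV[R]_q;
  st_x : forall i, 'cV[R]_(dimx (F i));
  st_xi : forall i, 'cV[R]_(dimx (F i));
  st_S : 'I_N -> 'M[R]_q;
  st_eta : 'I_N -> 'cV[R]_q;
  st_zeta : forall i, 'cV[R]_(q * (dimx (F i) + dimu (F i)))
}.

Section Signals.
Variables (z : state) (i : 'I_N).

Definition Xhat : 'M[R]_(dimx (F i), q) := usubmx (unvec (st_zeta z i)).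
Definition Uhat : 'M[R]_(dimu (F i), q) := dsubmx (unvec (st_zeta z i)).
Definition Keta : 'M[R]_(dimu (F i), q) := Uhat - Kx i *m Xhat.

Definition input : 'cV[R]_(dimu (F i)) :=
  Kx i *m st_xi z i + Keta *m st_eta z i.

Definition regulated_output : 'cV[R]_(dimu (F i)) :=
  fC (F i) *m st_x z i + fD (F i) *m input + fF (F i) *m st_v z.

Definition measurement : 'cV[R]_(dimy (F i)) :=
  fCm (F i) *m st_x z i + fDm (F i) *m input + fFm (F i) *m st_v z.

Definition Gmx : 'M[R]_(q * (dimx (F i) + dimu (F i))) := Qmx (F i) (st_S z i).

End Signals.

Definition closed_loop (z : nat -> state) : Prop :=
  forall t,
  st_v (z t.+1) = S *m st_v (z t) /\
  forall i,
  [/\ st_x (z t.+1) i = fA (F i) *m st_x (z t) i + fB (F i) *m input (z t) i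
        + fE (F i) *m st_v (z t),
      st_xi (z t.+1) i = fA (F i) *m st_xi (z t) i + fB (F i) *m input (z t) i
        + fE (F i) *m st_eta (z t) i
        + L i *m (fCm (F i) *m st_xi (z t) i + fDm (F i) *m input (z t) i
                  + fFm (F i) *m st_eta (z t) i - measurement (z t) i),
      st_S (z t.+1) i = st_S (z t) i + mu1 *: consensus a S (st_S (z t)) i,
      st_eta (z t.+1) i = st_S (z t) i *m st_eta (z t) i
        + mu2 *: (st_S (z t) i *m
                  consensus a (st_v (z t)) (st_eta (z t)) i)
    & st_zeta (z t.+1) i = st_zeta (z t) i
        - mu3 i *: ((Gmx (z t) i)^T *m
                    (Gmx (z t) i *m st_zeta (z t) i - bvec (F i)))].

Definition bounded_trajectory (z : nat -> state) : Prop :=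
  bounded_fun (fun t => st_v (z t)) /\
  forall i,
  [/\ bounded_fun (fun t => st_x (z t) i),
      bounded_fun (fun t => st_xi (z t) i),
      bounded_fun (fun t => st_S (z t) i),
      bounded_fun (fun t => st_eta (z t) i)
    & bounded_fun (fun t => st_zeta (z t) i)].

End ClosedLoop.

(* Main.v *)
(* All error signals decay exponentially, one after the other: S_i - S, then  *)
(* eta_i - v and zeta_i - vec (col (X_i, U_i)), then xi_i - x_i, then         *)
(* x_i - X_i v, hence e_i. Each obeys y(t+1) = A y(t) + P(t) y(t) + f(t) with *)
(* A Schur and P, f exponentially decaying, which forces y to decay           *)
(* exponentially. Since the spectrum of S lies in the closed unit disc, v     *)
(* grows more slowly than any r^t with r > 1, so multiplying v by a decaying  *)
(* factor gives a decaying signal even when v is unbounded.                   *)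

Require Import Defs.
From HB Require Import structures.
From mathcomp Require Import all_boot all_order all_algebra.
From mathcomp Require Import all_classical all_reals all_analysis.
From mathcomp Require Import complex mxtens.
From mathcomp Require Import ring lra.

Set Implicit Arguments.
Unset Strict Implicit.
Unset Printing Implicit Defensive.

Import Order.TTheory GRing.Theory Num.Theory.
Import numFieldNormedType.Exports.

Local Open Scope classical_set_scope.
Local Open Scope ring_scope.

(** * Growth of matrix powers *)

(** The closed loop is a cascade: the estimates of [S] evolve by themselves, they drive [st_eta] and
    [st_zeta], and these drive the observer and then the plant. Every layer reduces to
    [schur_perturbed_decay], so it remains to exhibit the Schur matrix of each layer and to see why
    its perturbation vanishes.

    For the consensus on [S] and for the regulator solver the matrix has the form [1%:M - mu *: A],
    and [rho] is the quantity for which [schur_gradient_step] works once the spectrum of [A] lies in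
    the open right half-plane. For [Hmx a] this is where reachability from the leader enters
    ([Hmx_spectrum_gt0]); for the Gram matrix of [Qmx] it follows from invertibility
    ([gram_spectrum_gt0]), hence from unique solvability of the regulator equations ([Qmx_unit]).
    The other Schur matrices are given by hypothesis.

    [powers_growth] serves twice: it bounds the leader at every geometric rate above 1, and it feeds
    [adapted_norm], a norm in which a Schur matrix contracts. The regulator equations make
    [x = X v], [u = U v] an invariant motion with zero output, to which each follower converges.
    Boundedness passes from [v] to every signal, since each is a bounded signal plus a decaying
    error. *)

Section MatrixNorm.
Variable K : numDomainType.

Lemma mx_norm_ge_entry m n (M : 'M[K]_(m, n)) i j : `|M i j| <= `|M|.
Proof.
rewrite -[leRHS]/(mx_norm M) mx_normE -[leLHS]nngE num_le.
exact: (le_bigmax _ (fun ij => `|M ij.1 ij.2|%:nng) (i, j)).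
Qed.

Lemma mx_norm_leP m n (M : 'M[K]_(m, n)) (c : K) :
  0 <= c -> reflect (forall i j, `|M i j| <= c) (`|M| <= c).
Proof.
move=> c0; apply: (iffP idP) => [Mc i j|Mc].
  exact: le_trans (mx_norm_ge_entry M i j) Mc.
have -> : c = (NngNum c0)%:num by [].
rewrite -[leLHS]/(mx_norm M) mx_normE num_le; apply/bigmax_leP; split => // -[i j] _.
by rewrite -num_le /=; exact: Mc.
Qed.

(** The norm is the largest entry modulus, which is not submultiplicative: an entry of the product
    sums [n] terms, hence the factor. *)
Lemma mx_norm_mulmx m n p (A : 'M[K]_(m, n)) (B : 'M[K]_(n, p)) :
  `|A *m B| <= n%:R * `|A| * `|B|.
Proof.
apply/mx_norm_leP => [|i j]; first by rewrite !mulr_ge0.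
rewrite mxE; apply: le_trans (ler_norm_sum _ _ _) _.
have -> : n%:R * `|A| * `|B| = \sum_(k < n) `|A| * `|B|.
  by rewrite sumr_const card_ord -mulrA mulr_natl.
apply: ler_sum => k _; rewrite normrM.
by apply: ler_pM => //; exact: mx_norm_ge_entry.
Qed.

Lemma mx_norm_trmx m n (A : 'M[K]_(m, n)) : `|A^T| = `|A|.
Proof.
apply/le_anti/andP; split; apply/mx_norm_leP => // i j.
  by rewrite mxE; exact: mx_norm_ge_entry.
by have := mx_norm_ge_entry A^T j i; rewrite mxE.
Qed.

End MatrixNorm.

Section MatrixPowers.

(* With s the eigenvalues of A the product vanishes by Cayley-Hamilton; the   *)
(* factors A - l are then removed one at a time, as w(t) = A^t P satisfies    *)
(* w(t+1) = l w(t) + A^t (A - l) P.                                           *)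
Lemma powers_growth_of_factors (K : numClosedFieldType) n (A P : 'M[K]_n.+1)
    (s : seq K) (r : K) : 0 < r -> all (fun l => `|l| < r) s ->
  (exists C, forall t,
     `|A ^+ t * (\prod_(l <- s) (A - l%:M)) * P| <= C * r ^+ t) ->
  exists C, forall t, `|A ^+ t * P| <= C * r ^+ t.
Proof.
move=> r0; elim: s => [|l s IH] /=.
  by move=> _ [C AC]; exists C => t; have := AC t; rewrite big_nil mulr1.
move=> /andP[lr sr] [C0 AC]; apply: IH => //.
rewrite big_cons in AC; set Q := \prod_(_ <- s) _ in AC *.
have rl : 0 < r - `|l| by rewrite subr_gt0.
have C00 : 0 <= C0.
  by have := AC 0%N; rewrite expr0 mulr1; exact: le_trans.
(* The first summand covers t = 0; the second gives |l| D + C0 <= r D for the sum D, which closes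
   the induction. *)
exists (`|Q * P| + C0 / (r - `|l|)); elim => [|t IHt].
  by rewrite expr0 mul1r expr0 mulr1 lerDl divr_ge0 // ltW.
have -> : A ^+ t.+1 * Q * P =
    l *: (A ^+ t * Q * P) + A ^+ t * ((A - l%:M) * Q) * P.
  rewrite exprSr mulrBl mulrBr mulrBl -scalemx1 -!mulmxE -!scalemxAl mul1mx.
  by rewrite !mulmxE -scalerAr -scalerAl addrC !mulrA subrK.
apply: le_trans (ler_normD _ _) _; rewrite mx_normZ.
set D := `|Q * P| + _ in IHt *.
apply: (@le_trans _ _ (`|l| * (D * r ^+ t) + C0 * r ^+ t)).
  by apply: lerD => //; exact: ler_wpM2l.
rewrite exprS mulrA -mulrDl mulrA; apply: ler_wpM2r.
  by rewrite exprn_ge0 // ltW.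
have DC : C0 <= D * (r - `|l|).
  by rewrite /D mulrDl divfK ?gt_eqF // lerDr mulr_ge0 // ltW.
by rewrite [`|l| * _]mulrC -lerBrDl -mulrBr.
Qed.

Lemma powers_growth_closed (K : numClosedFieldType) n (A : 'M[K]_n.+1) (r : K) :
  0 < r -> (forall l, eigenvalue A l -> `|l| < r) ->
  exists C, forall t, `|A ^+ t| <= C * r ^+ t.
Proof.
move=> r0 Ar; have [s ps] := closed_field_poly_normal (char_poly A).
rewrite (monicP (char_poly_monic A)) scale1r in ps.
suff [C AC] : exists C, forall t, `|A ^+ t * 1| <= C * r ^+ t.
  by exists C => t; rewrite -[A ^+ t]mulr1.
apply: (@powers_growth_of_factors _ _ _ _ s) => //.
  apply/allP => l ls; apply: Ar.
  by rewrite eigenvalue_root_char ps root_prod_XsubC.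
exists 0 => t; rewrite mul0r.
have -> : \prod_(l <- s) (A - l%:M) = horner_mx A (char_poly A).
  rewrite ps rmorph_prod /=; apply: eq_bigr => l _.
  by rewrite rmorphB /= horner_mx_X horner_mx_C.
by rewrite Cayley_Hamilton mulr0 mul0r normr0.
Qed.

Variable R : realType.

Lemma real_complex_normc (z : complex R) : `|z| = (Normc.normc z)%:C%C.
Proof. by []. Qed.

(** The strict gap between the spectrum and [r] absorbs the polynomial factors of Jordan blocks. The
    complex bound descends to the reals because a nonnegative element of [complex R] is real. *)
Lemma powers_growth n (A : 'M[R]_n) (r : R) : 0 < r ->
  (forall l, spectrum A l -> Normc.normc l < r) ->
  exists C, forall t, `|A ^+ t| <= C * r ^+ t.
Proof.
case: n A => [|n] A r0 Ar.
  by exists 0 => t; rewrite [A ^+ t]flatmx0 normr0 mul0r.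
have [||C AC] := @powers_growth_closed _ _ (map_mx (real_complex R) A) r%:C%C.
- by rewrite ltcR.
- by move=> l /Ar; rewrite real_complex_normc ltcR.
have C0 : 0 <= C by have := AC 0%N; rewrite expr0 mulr1; exact: le_trans.
have CE : C = (complex.Re C)%:C%C by rewrite RRe_real // ger0_real.
exists (complex.Re C) => t; apply/mx_norm_leP => [|i j].
  by rewrite mulr_ge0 ?exprn_ge0 ?(ltW r0) // -ler0c -CE.
rewrite -lecR rmorphM rmorphXn /= -CE; apply: le_trans (AC t).
have -> : `|(A ^+ t) i j|%:C%C = `|(map_mx (real_complex R) A ^+ t) i j|.
  have := rmorphXn (map_mx (real_complex R)) t A.
  move=> /= <-; rewrite mxE.
  by rewrite real_complex_normc /= expr0n addr0 sqrtr_sqr.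
exact: mx_norm_ge_entry.
Qed.

End MatrixPowers.

(** * Exponentially decaying sequences *)

Section Decay.
Variable R : realType.

Definition geo_bounded m n (r : R) (u : nat -> 'M[R]_(m, n)) :=
  exists C, forall t, `|u t| <= C * r ^+ t.

Definition exp_decay m n (u : nat -> 'M[R]_(m, n)) :=
  exists2 r, 0 < r < 1 & geo_bounded r u.

(** The growth class of the leader: eigenvalues on the unit circle still allow polynomial growth. *)
Definition subexp m n (u : nat -> 'M[R]_(m, n)) :=
  forall r, 1 < r -> geo_bounded r u.

Definition norm_bounded m n (u : nat -> 'M[R]_(m, n)) :=
  exists C, forall t, `|u t| <= C.

Lemma geo_bounded_ge0 m n (r : R) (u : nat -> 'M[R]_(m, n)) :
  geo_bounded r u -> exists2 C, 0 <= C & forall t, `|u t| <= C * r ^+ t.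
Proof.
move=> [C uC]; exists C => //.
by have := uC 0%N; rewrite expr0 mulr1; exact: le_trans.
Qed.

Lemma geo_bounded_le m n (r s : R) (u : nat -> 'M[R]_(m, n)) :
  0 <= r <= s -> geo_bounded r u -> geo_bounded s u.
Proof.
move=> /andP[r0 rs] /geo_bounded_ge0[C C0 uC]; exists C => t.
apply: le_trans (uC t) _; apply: ler_wpM2l => //.
by apply: lerXn2r => //; rewrite nnegrE (le_trans r0).
Qed.

Lemma exp_decayD m n (u v : nat -> 'M[R]_(m, n)) :
  exp_decay u -> exp_decay v -> exp_decay (fun t => u t + v t).
Proof.
move=> [r /andP[r0 r1] ur] [s /andP[s0 s1] vs].
exists (Num.max r s); first by rewrite lt_max r0 gt_max r1.
have [|C uC] := geo_bounded_le _ ur (s := Num.max r s).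
  by rewrite ltW // le_max lexx.
have [|D vD] := geo_bounded_le _ vs (s := Num.max r s).
  by rewrite ltW // le_max lexx orbT.
exists (C + D) => t; rewrite mulrDl.
by apply: le_trans (ler_normD _ _) _; exact: lerD.
Qed.

Lemma exp_decayN m n (u : nat -> 'M[R]_(m, n)) :
  exp_decay u -> exp_decay (fun t => - u t).
Proof. by move=> [r r01 [C uC]]; exists r => //; exists C => t; rewrite normrN. Qed.

Lemma exp_decayB m n (u v : nat -> 'M[R]_(m, n)) :
  exp_decay u -> exp_decay v -> exp_decay (fun t => u t - v t).
Proof. by move=> ud vd; apply: exp_decayD => //; exact: exp_decayN. Qed.

Lemma exp_decayZ m n (c : R) (u : nat -> 'M[R]_(m, n)) :
  exp_decay u -> exp_decay (fun t => c *: u t).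
Proof.
move=> [r r01 [C uC]]; exists r => //; exists (`|c| * C) => t.
by rewrite mx_normZ -mulrA; exact: ler_wpM2l.
Qed.

Lemma exp_decay0 m n : exp_decay (fun=> 0 : 'M[R]_(m, n)).
Proof.
exists 2^-1; first by rewrite invr_gt0 ltr0n invf_lt1 ?ltr1n.
by exists 0 => t; rewrite normr0 mul0r.
Qed.

Lemma exp_decay_sum m n (I : finType) (u : I -> nat -> 'M[R]_(m, n)) :
  (forall i, exp_decay (u i)) -> exp_decay (fun t => \sum_i u i t).
Proof.
move=> ud; elim: (index_enum I) => [|i s IH].
  by under eq_fun do rewrite big_nil; exact: exp_decay0.
by under eq_fun do rewrite big_cons; exact: exp_decayD.
Qed.

Lemma exp_decay_trmx m n (u : nat -> 'M[R]_(m, n)) :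
  exp_decay u -> exp_decay (fun t => (u t)^T).
Proof. by move=> [r r01 [C uC]]; exists r => //; exists C => t; rewrite mx_norm_trmx. Qed.

Lemma geo_bounded_mulmx m n p (r s : R)
    (u : nat -> 'M[R]_(m, n)) (v : nat -> 'M[R]_(n, p)) :
  geo_bounded r u -> geo_bounded s v ->
  geo_bounded (r * s) (fun t => u t *m v t).
Proof.
move=> /geo_bounded_ge0[C C0 uC] /geo_bounded_ge0[D D0 vD].
exists (n%:R * C * D) => t; apply: le_trans (mx_norm_mulmx _ _) _.
have -> : n%:R * C * D * (r * s) ^+ t = n%:R * (C * r ^+ t) * (D * s ^+ t).
  by rewrite exprMn; ring.
by apply: ler_pM => //; apply: ler_wpM2l.
Qed.

Lemma exp_decay_mulmx m n p (u : nat -> 'M[R]_(m, n)) (v : nat -> 'M[R]_(n, p)) :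
  exp_decay u -> subexp v -> exp_decay (fun t => u t *m v t).
Proof.
(* Bounding [v] at the rate (1 + 1/r)/2 > 1 gives the product the rate (1 + r)/2 < 1. *)
move=> [r /andP[r0 r1] ur] vs; exists (r * ((1 + r^-1) / 2)).
  by rewrite mulrA mulrDr mulr1 divff ?gt_eqF //; lra.
by apply: geo_bounded_mulmx => //; apply: vs; have := invf_gt1 r0; rewrite r1; lra.
Qed.

Lemma subexp_mulmx m n p (u : nat -> 'M[R]_(m, n)) (v : nat -> 'M[R]_(n, p)) :
  subexp u -> exp_decay v -> exp_decay (fun t => u t *m v t).
Proof.
move=> us vd; under eq_fun do rewrite -[_ *m _]trmxK trmx_mul.
apply/exp_decay_trmx/exp_decay_mulmx; first exact: exp_decay_trmx.
move=> r r1; have [C uC] := us r r1; exists C => t.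
by rewrite mx_norm_trmx.
Qed.

Lemma norm_bounded_subexp m n (u : nat -> 'M[R]_(m, n)) :
  norm_bounded u -> subexp u.
Proof.
move=> [C uC] r r1; exists C => t; apply: le_trans (uC t) _.
rewrite ler_peMr ?exprn_ege1 ?(ltW r1) //.
exact: le_trans (normr_ge0 _) (uC t).
Qed.

Lemma exp_decay_bounded m n (u : nat -> 'M[R]_(m, n)) :
  exp_decay u -> norm_bounded u.
Proof.
move=> [r /andP[r0 r1] /geo_bounded_ge0[C C0 uC]]; exists C => t.
by apply: le_trans (uC t) _; rewrite ler_piMr // exprn_ile1 // ltW.
Qed.

Lemma norm_bounded_cst m n (M : 'M[R]_(m, n)) : norm_bounded (fun=> M).
Proof. by exists `|M|. Qed.

Lemma norm_boundedD m n (u v : nat -> 'M[R]_(m, n)) :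
  norm_bounded u -> norm_bounded v -> norm_bounded (fun t => u t + v t).
Proof.
move=> [C uC] [D vD]; exists (C + D) => t.
by apply: le_trans (ler_normD _ _) _; exact: lerD.
Qed.

Lemma norm_bounded_mulmx m n p (M : 'M[R]_(m, n)) (u : nat -> 'M[R]_(n, p)) :
  norm_bounded u -> norm_bounded (fun t => M *m u t).
Proof.
move=> [C uC]; exists (n%:R * `|M| * C) => t.
by apply: le_trans (mx_norm_mulmx _ _) _; apply: ler_wpM2l; rewrite ?mulr_ge0.
Qed.

Lemma exp_decay_mulmxl m n p (M : 'M[R]_(m, n)) (u : nat -> 'M[R]_(n, p)) :
  exp_decay u -> exp_decay (fun t => M *m u t).
Proof. by apply: subexp_mulmx; exact/norm_bounded_subexp/norm_bounded_cst. Qed.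

Lemma norm_boundedP m n (u : nat -> 'M[R]_(m, n)) :
  norm_bounded u <-> bounded_fun u.
Proof.
have ? : ProperFilter (globally [set: nat]).
  exact: (@globally_properfilter _ _ 0%N).
split=> [[C uC]|/ex_bound[C uC]]; last by exists C => t; exact: uC.
by apply/ex_bound; exists C => t _; exact: uC.
Qed.

Lemma exp_decay_cvg0 m n (u : nat -> 'M[R]_(m, n)) :
  exp_decay u -> u @ \oo --> (0 : 'M[R]_(m, n)).
Proof.
move=> [r /andP[r0 r1] [C uC]]; apply/norm_cvg0P.
apply: (@squeeze_cvgr _ _ _ _ (fun=> 0) (fun t => C * r ^+ t)).
- by near=> t; rewrite normr_ge0 uC.
- exact: cvg_cst.
- rewrite -[X in _ --> X](mulr0 C); apply: cvgMr; apply: cvg_expr.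
  by rewrite ger0_norm // ltW.
Unshelve. all: by end_near. Qed.

(* [fun x => sup_t |A^t x| / r^t] is a norm for which A contracts by r. *)
Lemma adapted_norm n k (A : 'M[R]_n) (r : R) : 0 < r ->
  (exists C, forall t, `|A ^+ t| <= C * r ^+ t) ->
  exists (V : 'M[R]_(n, k) -> R) (D : R),
    [/\ forall x, `|x| <= V x, forall x, V x <= D * `|x|,
        forall x y, V (x + y) <= V x + V y & forall x, V (A *m x) <= r * V x].
Proof.
move=> r0 [C AC].
pose f (x : 'M[R]_(n, k)) t := `|A ^+ t *m x| / r ^+ t.
have fub x t : f x t <= n%:R * C * `|x|.
  rewrite /f ler_pdivrMr ?exprn_gt0 //; apply: le_trans (mx_norm_mulmx _ _) _.
  by rewrite [leRHS]mulrAC ler_wpM2r // -mulrA ler_wpM2l.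
have fsup x : has_sup (range (f x)).
  split; first by exists (f x 0%N); exists 0%N.
  by exists (n%:R * C * `|x|) => _ [t _ <-].
have fV x t : f x t <= sup (range (f x)) by apply: ub_le_sup; [case: (fsup x)|exists t].
have Vle x c : (forall t, f x t <= c) -> sup (range (f x)) <= c.
  by move=> fc; apply: ge_sup; [case: (fsup x)|move=> _ [t _ <-]].
exists (fun x => sup (range (f x))), (n%:R * C); split.
- by move=> x; have := fV x 0%N; rewrite /f expr0 mul1mx divr1.
- by move=> x; exact: Vle.
- move=> x y; apply: Vle => t; apply: le_trans (lerD (fV x t) (fV y t)).
  rewrite /f mulmxDr -mulrDl ler_wpM2r ?invr_ge0 ?exprn_ge0 ?(ltW r0) //.
  exact: ler_normD.
- move=> x; apply: Vle => t; apply: le_trans (ler_wpM2l (ltW r0) (fV x t.+1)).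
  by rewrite /f mulmxA mulmxE -exprSr [r ^+ t.+1]exprS invfM mulrCA mulVKf ?gt_eqF.
Qed.

(** The excesses c p^t over [r] are summable, so the product of the factors grows no faster than a
    constant times s^t, for any s < 1 with r <= s and p < s. *)
Lemma perturbed_contraction (V : nat -> R) (r p c d : R) :
  0 < r < 1 -> 0 < p < 1 -> 0 <= c -> 0 <= d -> (forall t, 0 <= V t) ->
  (forall t, V t.+1 <= (r + c * p ^+ t) * V t + d * p ^+ t) ->
  exists2 s, 0 < s < 1 & exists C, forall t, V t <= C * s ^+ t.
Proof.
move=> /andP[r0 r1] /andP[p0 p1] c0 d0 V0 VS.
have [s [rs ps s1]] : exists s, [/\ r <= s, p < s & s < 1].
  exists ((1 + Num.max r p) / 2).
  have : r <= Num.max r p by rewrite le_max lexx.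
  have : p <= Num.max r p by rewrite le_max lexx orbT.
  have : Num.max r p < 1 by rewrite gt_max r1.
  by move=> *; split; lra.
have s0 : 0 < s by exact: lt_trans ps.
exists s; first by rewrite s0.
pose K := d / (s - p); have K0 : 0 <= K by rewrite divr_ge0 // subr_ge0 ltW.
have dK : s * K = d + p * K.
  by apply/eqP; rewrite -subr_eq -mulrBl /K mulrC divfK // subr_eq0 gt_eqF.
(* K is chosen so that W absorbs the forcing term d p^t. *)
pose W t := V t + K * p ^+ t; pose e t := c / s * ((1 - p ^+ t) / (1 - p)).
have pt0 t : 0 <= p ^+ t by rewrite exprn_ge0 // ltW.
have W0 t : 0 <= W t by rewrite addr_ge0 // mulr_ge0.
have WS t : W t.+1 <= s * expR (c / s * p ^+ t) * W t.
  apply: (@le_trans _ _ ((s + c * p ^+ t) * W t)).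
    apply: le_trans (lerD (VS t) (lexx _)) _.
    have -> : (s + c * p ^+ t) * W t =
        s * V t + c * p ^+ t * V t + (s * K) * p ^+ t + c * K * p ^+ t * p ^+ t.
      by rewrite /W; ring.
    rewrite dK exprS; have := ler_wpM2r (V0 t) rs.
    have := mulr_ge0 (mulr_ge0 (mulr_ge0 c0 K0) (pt0 t)) (pt0 t); lra.
  apply: ler_wpM2r => //.
  have -> : s + c * p ^+ t = s * (1 + c / s * p ^+ t).
    by rewrite mulrDr mulr1 -mulrA mulrCA [s * (_ * _)]mulrA divff ?gt_eqF ?mul1r.
  by apply: ler_wpM2l; [exact: ltW | exact: expR_ge1Dx].
(* [e t] is the closed form of the sum of (c/s) p^k over k < t; with 1 + x <= exp x, [expR (e t)]
   dominates the accumulated excess and stays bounded. *)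
have eS t : e t.+1 = c / s * p ^+ t + e t.
  by rewrite /e exprS; field; rewrite !gt_eqF ?subr_gt0.
have We t : W t <= W 0%N * s ^+ t * expR (e t).
  elim: t => [|t IH].
    by rewrite /e !expr0 subrr mul0r mulr0 expR0 !mulr1.
  apply: le_trans (WS t) _; rewrite eS expRD.
  have -> : W 0%N * s ^+ t.+1 * (expR (c / s * p ^+ t) * expR (e t)) =
     s * expR (c / s * p ^+ t) * (W 0%N * s ^+ t * expR (e t)).
    by rewrite exprS; ring.
  by apply: ler_wpM2l => //; rewrite mulr_ge0 ?expR_ge0 // ltW.
exists (W 0%N * expR (c / s * (1 / (1 - p)))) => t.
apply: (@le_trans _ _ (W t)); first by rewrite lerDl mulr_ge0.
apply: le_trans (We t) _; rewrite mulrAC; apply: ler_wpM2r.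
  by rewrite exprn_ge0 // ltW.
apply: ler_wpM2l => //; rewrite ler_expR /e; apply: ler_wpM2l.
  by rewrite divr_ge0 // ltW.
by apply: ler_wpM2r; [rewrite invr_ge0 subr_ge0 ltW | rewrite gerBl].
Qed.

Lemma spectrum_seq n (A : 'M[R]_n) :
  exists s : seq (complex R), forall l, spectrum A l -> l \in s.
Proof.
pose AC := map_mx (real_complex R) A.
have [s ps] := closed_field_poly_normal (char_poly AC); exists s => l.
rewrite /spectrum /= eigenvalue_root_char ps.
by rewrite (monicP (char_poly_monic AC)) scale1r root_prod_XsubC.
Qed.

Lemma schur_gap n (A : 'M[R]_n) : schur A ->
  exists2 r, 0 < r < 1 & forall l, spectrum A l -> Normc.normc l < r.
Proof.
move=> sA; have [s As] := spectrum_seq A.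
(* Members of [s] are not known to be eigenvalues, so the bound is asked only of those inside the
   unit disc. *)
suff [r r01 rs] : exists2 r : R, 0 < r < 1 &
    forall l, l \in s -> Normc.normc l < 1 -> Normc.normc l < r.
  by exists r => // l Al; apply: rs; [exact: As | exact: sA].
elim: s {As} => [|l s [r /andP[r0 r1] rs]].
  by exists 2^-1 => //; rewrite invr_gt0 ltr0n invf_lt1 ?ltr1n.
have [l1|l1] := ltP (Normc.normc l) 1; last first.
  exists r; first by rewrite r0.
  by move=> k; rewrite inE => /orP[/eqP->|/rs//]; rewrite ltNge l1.
exists ((1 + Num.max r (Normc.normc l)) / 2).
  have : r <= Num.max r (Normc.normc l) by rewrite le_max lexx.
  have : Num.max r (Normc.normc l) < 1 by rewrite gt_max r1.
  by move=> *; apply/andP; split; lra.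
have h1 : Num.max r (Normc.normc l) < 1 by rewrite gt_max r1.
have h2 : Normc.normc l <= Num.max r (Normc.normc l) by rewrite le_max lexx orbT.
have h3 : r <= Num.max r (Normc.normc l) by rewrite le_max lexx.
move=> k; rewrite inE => /orP[/eqP-> _|/rs kr k1]; first by lra.
by have := kr k1; lra.
Qed.

(** In the adapted norm [A] contracts by some r < 1, while [P] and [f] contribute geometric terms to
    the factor and to the forcing, so [perturbed_contraction] applies. *)
Lemma schur_perturbed_decay n k (A : 'M[R]_n) (P : nat -> 'M[R]_n)
    (f x : nat -> 'M[R]_(n, k)) :
  schur A -> exp_decay P -> exp_decay f ->
  (forall t, x t.+1 = A *m x t + P t *m x t + f t) -> exp_decay x.
Proof.
move=> /schur_gap[r r01 Ar] [p1 /andP[p10 p11] Pp] [p2 /andP[p20 p21] fp] xS.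
have [r0 r1] := andP r01.
have [V [D [xV VD VT VA]]] := adapted_norm k r0 (powers_growth r0 Ar).
pose p := Num.max p1 p2.
have [|{}P0 P00 {}Pp] := geo_bounded_ge0 (geo_bounded_le _ Pp (s := p)).
  by rewrite ltW // le_max lexx.
have [|{}f0 f00 {}fp] := geo_bounded_ge0 (geo_bounded_le _ fp (s := p)).
  by rewrite ltW // le_max lexx orbT.
have V0 y : 0 <= V y by exact: le_trans (xV y).
pose D' := `|D|; have D'0 : 0 <= D' by exact: normr_ge0.
have VD' y : V y <= D' * `|y|.
  by apply: le_trans (VD y) _; apply: ler_wpM2r => //; exact: ler_norm.
have [||||t|t|s s01 [C VC]] := @perturbed_contraction (V \o x) r p
  (D' * (n%:R * P0)) (D' * f0) => //.
- by rewrite lt_max p10 gt_max p11.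
- by rewrite !mulr_ge0.
- by rewrite mulr_ge0.
- exact: V0.
- rewrite /= xS; apply: le_trans (VT _ _) _; apply: lerD; last first.
    by apply: le_trans (VD' _) _; rewrite -mulrA; apply: ler_wpM2l.
  apply: le_trans (VT _ _) _; rewrite mulrDl; apply: lerD => //.
  apply: le_trans (VD' _) _; rewrite -!mulrA; apply: ler_wpM2l => //.
  apply: le_trans (mx_norm_mulmx _ _) _; rewrite -mulrA; apply: ler_wpM2l => //.
  by rewrite mulrA; apply: ler_pM.
exists s => //; exists C => t; exact: le_trans (xV _) (VC t).
Qed.

End Decay.

(** * Spectra of gradient steps and of the graph matrix *)

Section Spectra.
Variable R : realType.
Local Notation toC := (real_complex R).

Lemma normc_sqr (l : complex R) :
  Normc.normc l ^+ 2 = complex.Re l ^+ 2 + complex.Im l ^+ 2.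
Proof. by case: l => x y /=; rewrite sqr_sqrtr // addr_ge0 // sqr_ge0. Qed.

Lemma rho_ge n (A : 'M[R]_n) l : spectrum A l ->
  Normc.normc l ^+ 2 / complex.Re l <= rho A.
Proof.
move=> Al; apply: ub_le_sup; last by exists l.
have [s As] := spectrum_seq A.
exists (\sum_(k <- s) `|Normc.normc k ^+ 2 / complex.Re k|) => _ [k /As ks <-].
rewrite (big_rem k) //=; apply: le_trans (ler_norm _) _.
by rewrite lerDl sumr_ge0.
Qed.

(** An eigenvalue is 1 - mu k with k in the spectrum of [A], and |1 - mu k|^2 - 1 = mu (mu |k|^2 - 2
    Re k), which is negative exactly when mu |k|^2 / Re k < 2. *)
Lemma schur_gradient_step n (A : 'M[R]_n) (mu : R) :
  (forall l, spectrum A l -> 0 < complex.Re l) -> 0 < mu < 2 / rho A ->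
  schur (1%:M - mu *: A).
Proof.
move=> Apos /andP[mu0 muA] l /eigenvalueP[w wl w0].
have mu0' : toC mu != 0 by rewrite fmorph_eq0 gt_eqF.
pose k := (1 - l) / toC mu.
have Ak : spectrum A k.
  apply/eigenvalueP; exists w => //.
  move: wl; rewrite map_mxB map_mxZ map_mx1 mulmxBr mulmx1 -scalemxAr => wl.
  apply: (scalerI mu0'); rewrite scalerA mulrC divfK // scalerBl scale1r -wl.
  by rewrite opprB addrC subrK.
have lE : l = 1 - toC mu * k by rewrite mulrC divfK // opprB addrC subrK.
have := rho_ge Ak; have := Apos _ Ak; rewrite normc_sqr lE.
move: k {Ak lE} => -[x y] /= x0 xy.
have rho0 : 0 < rho A.
  apply: lt_le_trans xy; rewrite divr_gt0 // ltr_pwDl ?sqr_ge0 //.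
  by rewrite exprn_gt0.
rewrite ltr_pdivlMr // in muA; rewrite ler_pdivrMr // in xy.
rewrite /Normc.normc -[ltRHS]sqrtr1 ltr_sqrt ?ltr01 //=.
have h : mu * (x ^+ 2 + y ^+ 2) < 2 * x.
  apply: le_lt_trans (ler_wpM2l (ltW mu0) xy) _.
  by rewrite mulrA ltr_pM2r.
have := ltr_pM2l mu0 (mu * (x ^+ 2 + y ^+ 2)) (2 * x); rewrite h => h'.
rewrite -subr_lt0.
have -> : (1 - (mu * x - 0 * y)) ^+ 2 + (0 - (mu * y + 0 * x)) ^+ 2 - 1 =
  mu * (mu * (x ^+ 2 + y ^+ 2)) - mu * (2 * x) by ring.
by rewrite subr_lt0 h'.
Qed.

(** For a row eigenvector v and w = v Q^T, Hermitian norms give l |v|^2 = |w|^2, and w is nonzero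
    because [Q] is invertible. *)
Lemma gram_spectrum_gt0 n (Q : 'M[R]_n) : Q \in unitmx ->
  forall l, spectrum (Q^T *m Q) l -> 0 < complex.Re l.
Proof.
move=> Qu l /eigenvalueP[v vl v0].
pose QC := map_mx toC Q; pose w := v *m QC^T.
pose sqn (u : 'rV[complex R]_n) := u *m (map_mx (@conjc R) u)^T.
have sqnE u : sqn u 0 0 = \sum_i `|u 0 i| ^+ 2.
  by rewrite mxE; apply: eq_bigr => i _; rewrite !mxE sqr_normc.
have sqn_gt0 u : u != 0 -> 0 < sqn u 0 0.
  move=> u0; rewrite sqnE lt_def sumr_ge0 ?andbT; last first.
    by move=> i _; rewrite exprn_ge0.
  apply: contra u0 => /eqP /psumr_eq0P u0; apply/eqP/rowP => i.
  rewrite mxE; apply/eqP; rewrite -normr_eq0 -sqrf_eq0; apply/eqP.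
  by apply: u0 => // j _; rewrite exprn_ge0.
have w0 : w != 0.
  apply: contra v0 => /eqP w0; apply/eqP.
  have QTu : QC^T \in unitmx by rewrite unitmx_tr map_unitmx.
  by rewrite -(mulmxK QTu v) -/w w0 mul0mx.
have conjw : map_mx (@conjc R) w = map_mx (@conjc R) v *m QC^T.
  rewrite map_mxM; congr (_ *m _); apply/matrixP => i j.
  by rewrite /QC !mxE [LHS]conjc_real.
have lw : l * sqn v 0 0 = sqn w 0 0.
  rewrite /sqn conjw trmx_mul trmxK mulmxA.
  have -> : w *m QC = l *: v.
    by rewrite -vl map_mxM /w /QC matrix.map_trmx mulmxA.
  by rewrite -scalemxAl [RHS]mxE.
have : 0 < l.
  have := sqn_gt0 _ w0; rewrite -lw.
  by rewrite pmulr_lgt0 // sqn_gt0.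
by rewrite ltcE => /andP[].
Qed.

Lemma eigenvalue_trmx (K : fieldType) n (A : 'M[K]_n) l :
  eigenvalue A^T l = eigenvalue A l.
Proof.
rewrite /eigenvalue /eigenspace !kermx_eq0 !row_free_unit -unitmx_tr.
by rewrite linearB /= trmxK tr_scalar_mx.
Qed.

(** * The graph matrix: consensus errors and spectrum *)

Section Laplacian.
Variables (N : nat) (E : rel 'I_N.+1) (a : 'M[R]_N.+1).
Hypothesis a_adj : weighted_adjacency E a.

(** The diagonal of [Hmx] counts the edges from the leader, so [Hmx] acts as the Laplacian of the
    whole graph with the leader pinned at 0. The morphism [phi] allows both real errors and complex
    eigenvectors. *)
Lemma Hmx_sum (K : pzRingType) (phi : {rmorphism R -> K}) (z : 'I_N -> K) i :
  \sum_j phi (Hmx a i j) * z j =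
  \sum_k phi (a (lift ord0 i) k) * (z i - with_leader 0 z k).
Proof.
have wl0 : with_leader 0 z ord0 = 0 by rewrite /with_leader unlift_none.
have wlS j : with_leader 0 z (lift ord0 j) = z j by rewrite /with_leader liftK.
rewrite [RHS](eq_bigr (fun k => phi (a (lift ord0 i) k) * z i -
  phi (a (lift ord0 i) k) * with_leader 0 z k)); last by move=> k _; rewrite mulrBr.
rewrite sumrB -mulr_suml -rmorph_sum [in X in _ - X]big_ord_recl wl0 mulr0 add0r.
rewrite (bigD1 i) //= mxE eqxx; congr (_ + _).
rewrite [in RHS](bigD1 i) //= (proj1 a_adj) rmorph0 mul0r add0r -sumrN.
by apply: eq_bigr => j ji; rewrite mxE eq_sym (negPf ji) rmorphN mulNr wlS.
Qed.

Lemma consensusE n q (z0 : 'M[R]_(n, q)) (z : 'I_N -> 'M[R]_(n, q)) i :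
  consensus a z0 z i = - \sum_j Hmx a i j *: (z j - z0).
Proof.
apply/matrixP => k l; rewrite [RHS]mxE !summxE.
have := Hmx_sum idfun (fun j => z j k l - z0 k l) i => /= H.
rewrite (eq_bigr (fun j => Hmx a i j * (z j k l - z0 k l))); last first.
  by move=> j _; rewrite !mxE.
rewrite H -sumrN; apply: eq_bigr => j _; rewrite !mxE -mulrN opprB.
congr (_ * _); rewrite /with_leader; case: unlift => [m|]; ring.
Qed.

Lemma adj_ge0 i j : 0 <= a i j.
Proof.
have [_ /(_ i j)[Ea nEa]] := a_adj.
by case Eji: (E j i); [rewrite ltW // Ea | rewrite nEa ?Eji].
Qed.

Hypothesis E_tree : spanning_tree_from0 E.

(* Gershgorin's theorem puts l in the disc of radius h_ii centred at h_ii; if *)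
(* l = 0, the nodes where the eigenvector has maximal modulus are closed      *)
(* under predecessors, hence include the leader, where the vector is 0.       *)
Lemma Hmx_spectrum_gt0 l : spectrum (Hmx a) l -> 0 < complex.Re l.
Proof.
(* Eigenvectors are rows; transposing makes [v] a right eigenvector of [Hmx a], so that row sums
   appear. *)
rewrite /spectrum /= -eigenvalue_trmx => /eigenvalueP[v vl v0].
pose w k := with_leader 0 (v 0) k; pose nw k := Normc.normc (w k).
pose m : 'I_N.+1 := [arg max_(k > ord0) nw k]%O; pose M := nw m.
have nwM k : nw k <= M by rewrite /M /m; case: arg_maxP => // i _; exact.
have nw0 k : 0 <= nw k by rewrite /nw; case: (w k) => x y; exact: sqrtr_ge0.
have w_ord0 : w ord0 = 0 by rewrite /w /with_leader unlift_none.
have w_lift j : w (lift ord0 j) = v 0 j by rewrite /w /with_leader liftK.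
have M0 : 0 < M.
  case/rV0Pn: v0 => j vj0; apply: lt_le_trans (nwM (lift ord0 j)).
  rewrite lt_def nw0 andbT; apply: contra vj0 => /eqP.
  by move=> /Normc.eq0_normc; rewrite w_lift => ->.
have wl j : \sum_k toC (a (lift ord0 j) k) * w k =
    (toC (\sum_k a (lift ord0 j) k) - l) * w (lift ord0 j).
  have := congr1 (fun u : 'rV_N => u 0 j) vl; rewrite !mxE => vlj.
  have : \sum_k toC (Hmx a j k) * v 0 k = l * v 0 j.
    by rewrite -vlj; apply: eq_bigr => k _; rewrite !mxE mulrC.
  rewrite (Hmx_sum toC) mulrBl w_lift => <-.
  rewrite rmorph_sum mulr_suml -sumrB; apply: eq_bigr => k _.
  by rewrite mulrBr opprB addrC subrK.
have le_w j : Normc.normc ((toC (\sum_k a (lift ord0 j) k) - l) * w (lift ord0 j))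
    <= \sum_k a (lift ord0 j) k * nw k.
  rewrite -wl -lecR -real_complex_normc rmorph_sum.
  apply: le_trans (ler_norm_sum _ _ _) _; apply: ler_sum => k _.
  rewrite normrM rmorphM; apply: ler_wpM2r => //.
  by rewrite ger0_norm // ler0c adj_ge0.
have m_neq0 : m != ord0.
  apply: contraTneq M0 => m0.
  by rewrite /M m0 /nw w_ord0 [Normc.normc _]Normc.normc0 ltxx.
have [j mj] : exists j : 'I_N, m = lift ord0 j.
  by move: m_neq0; rewrite eq_sym => /unlift_some[j mj _]; exists j.
set h := \sum_k a (lift ord0 j) k.
have h_ge0 : 0 <= h by apply: sumr_ge0 => k _; exact: adj_ge0.
have : Normc.normc (toC h - l) <= h.
  have nwj : nw (lift ord0 j) = M by rewrite -mj.
  have := le_w j; rewrite Normc.normcM -/(nw (lift ord0 j)) nwj -/h => hM.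
  rewrite -(ler_pM2r M0); apply: le_trans hM _; rewrite /h mulr_suml.
  by apply: ler_sum => k _; apply: ler_wpM2l => //; exact: adj_ge0.
have l_neq0 : l != 0.
  apply/eqP => l0; pose P k := nw k == M.
  have P_pred i k : P i -> E k i -> P k.
    have [i0|i_neq0] := eqVneq i ord0.
      rewrite i0 /P /nw w_ord0 [Normc.normc _]Normc.normc0 => /eqP M00.
      by move: M0; rewrite -M00 ltxx.
    have [r ir] : exists r : 'I_N, i = lift ord0 r.
      by move: i_neq0; rewrite eq_sym => /unlift_some[r ir _]; exists r.
    move=> /eqP Pi Eki; have := le_w r.
    rewrite l0 subr0 Normc.normcM -ir -/(nw i) Pi.
    have -> : Normc.normc (toC (\sum_k a i k)) = \sum_k a i k.
      rewrite /= expr0n addr0 sqrtr_sqr ger0_norm //.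
      by apply: sumr_ge0 => ? _; exact: adj_ge0.
    rewrite mulr_suml -subr_ge0 -sumrB => sum_ge0.
    have terms_ge0 s : 0 <= a i s * M - a i s * nw s.
      by rewrite subr_ge0; apply: ler_wpM2l => //; exact: adj_ge0.
    (* [sum_ge0] bounds this sum of nonnegative terms by 0, so each term vanishes and every
       in-neighbour of [i] attains [M]. *)
    have sum0 : \sum_s (a i s * M - a i s * nw s) = 0.
      apply: le_anti; rewrite sumr_ge0 ?andbT //.
      by rewrite -oppr_ge0 -sumrN; under eq_bigr do rewrite opprB.
    have /(_ k isT)/eqP := psumr_eq0P (fun s _ => terms_ge0 s) sum0.
    rewrite -mulrBr mulf_eq0 subr_eq0 [M == _]eq_sym => /orP[/eqP aik0|//].
    have [_ /(_ i k)[/(_ Eki)]] := a_adj.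
    by rewrite aik0 ltxx.
  have P_path : forall p r, path E r p -> P (last r p) -> P r.
    elim=> [//|s p IH] u /= /andP[Eus ps] Pp.
    by apply: P_pred Eus; exact: IH.
  case/connectP: (E_tree m) => p Ep mp.
  have : P ord0 by apply: P_path Ep _; rewrite -mp /P.
  rewrite /P /nw w_ord0 [Normc.normc _]Normc.normc0 => /eqP M00.
  by move: M0; rewrite -M00 ltxx.
(* If Re l <= 0, the disc inequality |h - l|^2 <= h^2 gives |l|^2 <= 2 h Re l <= 0, contradicting
   [l_neq0]. *)
move=> hl; rewrite ltNge; apply/negP => l_le0.
have := lerXn2r 2 _ _ hl; rewrite !nnegrE h_ge0.
have -> : 0 <= Normc.normc (toC h - l) by case: (toC h - l) => x y; exact: sqrtr_ge0.
rewrite normc_sqr => /(_ isT isT).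
case: l l_neq0 l_le0 {vl wl le_w hl} => x y; rewrite eq_complex /= => xy0 x0 hxy.
have : x ^+ 2 + y ^+ 2 = 0.
  have := sqr_ge0 x; have := sqr_ge0 y; have := mulr_ge0_le0 h_ge0 x0.
  move: hxy; rewrite !sub0r sqrrN => *; nra.
move/eqP; rewrite paddr_eq0 ?sqr_ge0 // !sqrf_eq0 => /andP[x00 y00].
by move: xy0; rewrite x00 y00.
Qed.

End Laplacian.
End Spectra.

(** * Vectorization and the regulator equations *)

Section Vectorization.
Variable R : realType.

Lemma vecE n q (Z : 'M[R]_(n, q)) k i : vec Z (mxtens_index (k, i)) 0 = Z i k.
Proof. by rewrite mxE mxtens_indexK. Qed.

Lemma vecK n q : cancel (@vec R n q) (@unvec R n q).
Proof. by move=> Z; apply/matrixP => i k; rewrite mxE vecE. Qed.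

Lemma unvecK n q : cancel (@unvec R n q) (@vec R n q).
Proof.
move=> X; apply/colP => k; case: (mxtens_indexP k) => i j.
by rewrite vecE mxE.
Qed.

Lemma vecB n q (Z W : 'M[R]_(n, q)) : vec (Z - W) = vec Z - vec W.
Proof. by apply/colP => k; rewrite !mxE. Qed.

Lemma vecD n q (Z W : 'M[R]_(n, q)) : vec (Z + W) = vec Z + vec W.
Proof. by apply/colP => k; rewrite !mxE. Qed.

Lemma vecZ n q c (Z : 'M[R]_(n, q)) : vec (c *: Z) = c *: vec Z.
Proof. by apply/colP => k; rewrite !mxE. Qed.

Lemma sum_mxtens m n (V : nmodType) (F : 'I_(m * n) -> V) :
  \sum_k F k = \sum_i \sum_j F (mxtens_index (i, j)).
Proof.
rewrite pair_bigA (reindex (fun ij : 'I_m * 'I_n => mxtens_index ij)) /=.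
  by apply: eq_bigr => -[].
by exists (@mxtens_unindex m n) => ij _; rewrite (mxtens_indexK, mxtens_unindexK).
Qed.

Lemma tensmx_vec n p q r (M : 'M[R]_(r, q)) (J : 'M[R]_(p, n)) (Z : 'M[R]_(n, q)) :
  (M *t J) *m vec Z = vec (J *m Z *m M^T).
Proof.
apply/colP => k; case: (mxtens_indexP k) => i j.
rewrite vecE [RHS]mxE mxE sum_mxtens.
apply: eq_bigr => c _; rewrite !mxE mulr_suml; apply: eq_bigr => d _.
by rewrite tensmxE vecE; ring.
Qed.

(** The errors [S_i - S] differ between followers, so they act on the stacked errors through
    distinct blocks, indexed as in [vec], and not through a Kronecker product. *)
Definition block_diag N q (T : 'I_N -> 'M[R]_q) : 'M[R]_(N * q) :=
  \matrix_(k, l) if (mxtens_unindex k).1 == (mxtens_unindex l).1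
                 then T (mxtens_unindex k).1 (mxtens_unindex k).2 (mxtens_unindex l).2
                 else 0.

Lemma block_diag_vec N q (T : 'I_N -> 'M[R]_q) (Z : 'M[R]_(q, N)) :
  block_diag T *m vec Z = vec (\matrix_(k, i) (T i *m col i Z) k 0).
Proof.
apply/colP => k; case: (mxtens_indexP k) => i j.
rewrite vecE [RHS]mxE [RHS]mxE [LHS]mxE sum_mxtens (bigD1 i) //=.
rewrite [X in _ + X]big1 ?addr0.
  by apply: eq_bigr => d _; rewrite !mxE !mxtens_indexK /= eqxx.
move=> c ci; apply: big1 => d _; rewrite !mxE !mxtens_indexK /=.
by rewrite eq_sym (negPf ci) mul0r.
Qed.

Lemma exp_decay_entryP m n (u : nat -> 'M[R]_(m, n)) :
  exp_decay u <-> forall i j, exp_decay (fun t => (u t i j)%:M : 'M[R]_1).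
Proof.
split=> [[r r01 [C uC]] i j | ud].
  exists r => //; exists C => t; apply/mx_norm_leP => [|k l].
    exact: le_trans (normr_ge0 _) (uC t).
  rewrite !ord1 mxE eqxx mulr1n.
  exact: le_trans (mx_norm_ge_entry _ _ _) (uC t).
have -> : u = (fun t => \sum_i \sum_j
    delta_mx i (0 : 'I_1) *m ((u t i j)%:M *m delta_mx 0 j)).
  apply/funext => t; rewrite [LHS]matrix_sum_delta.
  apply: eq_bigr => i _; apply: eq_bigr => j _.
  by rewrite mul_scalar_mx -scalemxAr mul_delta_mx.
apply: exp_decay_sum => i; apply: exp_decay_sum => j; apply: exp_decay_mulmxl.
apply: exp_decay_mulmx; first exact: ud.
exact/norm_bounded_subexp/norm_bounded_cst.
Qed.

End Vectorization.

Section Regulator.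
Variables (R : realType) (q : nat) (f : follower R q) (S : 'M[R]_q).

Lemma Qmx_vec (X : 'M[R]_(dimx f, q)) (U : 'M[R]_(dimu f, q)) :
  Qmx f S *m vec (col_mx X U) =
  vec (col_mx (X *m S - (fA f *m X + fB f *m U)) (- (fC f *m X + fD f *m U))).
Proof.
rewrite /Qmx mulmxBl !tensmx_vec -vecB trmxK trmx1 mulmx1; congr vec.
rewrite !mul_block_col !mul0mx !addr0 mul1mx mul_col_mx mul0mx opp_col_mx.
by rewrite add_col_mx sub0r.
Qed.

(** Hence the [st_zeta] update is a gradient step for the least-squares form of the regulator
    equations, with S_i(t) in place of [S]. *)
Lemma regulator_equationsE X U :
  regulator_equations S X U <-> Qmx f S *m vec (col_mx X U) = bvec f.
Proof.
rewrite Qmx_vec /bvec; split=> [[XS CX]|/(can_inj (@vecK _ _ _))/eq_col_mx[XS CX]].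
  congr (vec (col_mx _ _)); first by rewrite XS addrC addKr.
  by apply/eqP; rewrite eqr_oppLR -addr_eq0 -CX.
split; first by rewrite -XS addrC subrK.
by rewrite -CX subrr.
Qed.

(** A kernel vector, unstacked and added to the solution, gives another solution; uniqueness makes
    the kernel of this square matrix trivial. *)
Lemma Qmx_unit :
  (exists! XU : 'M[R]_(dimx f, q) * 'M[R]_(dimu f, q),
     regulator_equations S XU.1 XU.2) ->
  Qmx f S \in unitmx.
Proof.
move=> [[X U] /= [/regulator_equationsE XU uniq]].
rewrite -unitmx_tr -row_free_unit -kermx_eq0; apply/eqP/row_matrixP => i.
rewrite row0; set k := row i _.
have Qk : Qmx f S *m k^T = 0.
  have : k *m (Qmx f S)^T = 0 by apply: sub_kermxP; exact: row_sub.
  by move/(congr1 trmx); rewrite trmx_mul trmxK trmx0.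
pose Z := unvec k^T.
have : regulator_equations S (X + usubmx Z) (U + dsubmx Z).
  apply/regulator_equationsE; rewrite -add_col_mx vsubmxK vecD mulmxDr XU.
  by rewrite /Z unvecK Qk addr0.
move=> /(uniq (_, _))[]/eqP; rewrite -subr_eq0 opprD addNKr oppr_eq0 => /eqP Z1.
move=> /eqP; rewrite -subr_eq0 opprD addNKr oppr_eq0 => /eqP Z2.
apply: trmx_inj; rewrite -(unvecK k^T) -/Z -(vsubmxK Z) Z1 Z2 col_mx0 trmx0.
by apply/colP => j; rewrite !mxE.
Qed.

End Regulator.

(** * Closed-loop errors *)

Section TrackingErrors.
Variables (R : realType) (q N : nat) (S : 'M[R]_q) (F : 'I_N -> follower R q).
Variables (a : 'M[R]_N.+1) (mu1 mu2 : R) (mu3 : 'I_N -> R).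
Variables (Kx : forall i, 'M[R]_(dimu (F i), dimx (F i)))
          (L : forall i, 'M[R]_(dimx (F i), dimy (F i))).

(** The input depends only on [st_xi], [st_eta] and [st_zeta], so there is no algebraic loop and
    iterating this map produces the trajectory. *)
Definition closed_loop_step (z : state F) : state F :=
  State (S *m st_v z)
    (fun i => fA (F i) *m st_x z i + fB (F i) *m input Kx z i + fE (F i) *m st_v z)
    (fun i => fA (F i) *m st_xi z i + fB (F i) *m input Kx z i
        + fE (F i) *m st_eta z i
        + L i *m (fCm (F i) *m st_xi z i + fDm (F i) *m input Kx z i
                  + fFm (F i) *m st_eta z i - measurement Kx z i))
    (fun i => st_S z i + mu1 *: consensus a S (st_S z) i)
    (fun i => st_S z i *m st_eta z i
        + mu2 *: (st_S z i *m consensus a (st_v z) (st_eta z) i))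
    (fun i => st_zeta z i
        - mu3 i *: ((Gmx z i)^T *m (Gmx z i *m st_zeta z i - bvec (F i)))).

Lemma closed_loop_exists (z0 : state F) :
  exists z, z 0%N = z0 /\ closed_loop S a mu1 mu2 mu3 Kx L z.
Proof. by exists (fun t => iter t closed_loop_step z0); split=> // t; split. Qed.

Variable z : nat -> state F.
Hypothesis z_loop : closed_loop S a mu1 mu2 mu3 Kx L z.
Local Notation v t := (st_v (z t)).

Lemma leader_pow t : v t = S ^+ t *m v 0%N.
Proof.
elim: t => [|t IH]; first by rewrite expr0 mul1mx.
by have [-> _] := z_loop t; rewrite IH exprS mulmxA.
Qed.

Lemma leader_subexp : (forall l, spectrum S l -> Normc.normc l <= 1) ->
  subexp (fun t => v t).
Proof.
move=> S_eig r r1; under eq_fun do rewrite leader_pow.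
have [|l Sl|C SC] := @powers_growth R q S r; first exact: lt_trans r1.
  exact: le_lt_trans (S_eig l Sl) r1.
rewrite -[r]mulr1; apply: geo_bounded_mulmx; first by exists C.
by exists `|v 0%N| => t; rewrite expr1n mulr1.
Qed.

Hypothesis v_subexp : subexp (fun t => v t).
Variable E : rel 'I_N.+1.
Hypothesis a_adj : weighted_adjacency E a.

(** Consensus acts on each entry position separately: entry (k, l) of all the errors forms a vector
    obeying the unperturbed recursion. *)
Lemma S_error_decay : schur (1%:M - mu1 *: Hmx a) ->
  forall i, exp_decay (fun t => st_S (z t) i - S).
Proof.
move=> H_schur i; apply/exp_decay_entryP => k l.
pose x t : 'cV[R]_N := \col_j (st_S (z t) j - S) k l.
suff /exp_decay_entryP/(_ i 0) : exp_decay x by under eq_fun do rewrite mxE.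
apply: (schur_perturbed_decay H_schur (exp_decay0 _ _ _) (exp_decay0 _ _ _)).
move=> t; rewrite mul0mx !addr0 mulmxBl mul1mx -scalemxAl.
apply/colP => j; rewrite !mxE.
have [_ /(_ j)[_ _ -> _ _]] := z_loop t.
rewrite (consensusE a_adj) !mxE summxE addrAC mulrN; congr (_ + - (_ * _)).
by apply: eq_bigr => m _; rewrite !mxE.
Qed.

Hypothesis S_decay : forall i, exp_decay (fun t => st_S (z t) i - S).

(** Writing S_j = S + T_j splits the stacked error recursion into the nominal matrix, a decaying
    perturbation [P], and the forcing T_j v, which decays although v may grow. *)
Lemma eta_error_decay : schur ((1%:M : 'M[R]_N) *t S - mu2 *: (Hmx a *t S)) ->
  forall i, exp_decay (fun t => st_eta (z t) i - v t).
Proof.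
move=> HS_schur i.
pose Z t : 'M[R]_(q, N) := \matrix_(k, j) (st_eta (z t) j - v t) k 0.
have colZ t j : col j (Z t) = st_eta (z t) j - v t.
  by apply/colP => k; rewrite !mxE.
pose T t j := st_S (z t) j - S.
pose P t := block_diag (T t) *m (1%:M - mu2 *: (Hmx a *t (1%:M : 'M[R]_q))).
pose W t := vec (\matrix_(k < q, j < N) (T t j *m v t) k 0).
have Pd : exp_decay P.
  apply: exp_decay_mulmx; last exact/norm_bounded_subexp/norm_bounded_cst.
  apply/exp_decay_entryP => k l; under eq_fun do rewrite mxE.
  case: eqP => _; last first.
    by under eq_fun do rewrite -scalemx1 scale0r; exact: exp_decay0.
  have /exp_decay_entryP := S_decay (mxtens_unindex k).1.
  exact.
have Wd : exp_decay W.
  apply/exp_decay_entryP => k l; case: (mxtens_indexP k) => j m.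
  rewrite (ord1 l); under eq_fun do rewrite vecE mxE.
  have /exp_decay_entryP := exp_decay_mulmx (S_decay j) v_subexp.
  exact.
have /exp_decay_entryP Zd : exp_decay (fun t => vec (Z t)).
  apply: (schur_perturbed_decay HS_schur Pd Wd) => t.
  (* [M = S] is the nominal matrix; [M = 1] is the right factor of [P t]. *)
  have lin (M : 'M[R]_q) : ((1%:M : 'M[R]_N) *t M - mu2 *: (Hmx a *t M)) *m vec (Z t)
      = vec (M *m (Z t - mu2 *: (Z t *m (Hmx a)^T))).
    rewrite mulmxBl -scalemxAl !tensmx_vec trmx1 mulmx1 -vecZ -vecB.
    by rewrite mulmxBr -scalemxAr mulmxA.
  have tens1 : (1%:M : 'M[R]_N) *t (1%:M : 'M[R]_q) = 1%:M.
    apply/matrixP => k l; case: (mxtens_indexP k) => k1 k2.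
    case: (mxtens_indexP l) => l1 l2; rewrite tensmxE !mxE -natrM mulnb.
    by rewrite (can_eq (@mxtens_indexK _ _)) xpair_eqE.
  rewrite /P -[in RHS]tens1 -[block_diag _ *m _ *m _]mulmxA !lin mul1mx.
  rewrite block_diag_vec -!vecD; congr vec; apply/matrixP => k j.
  have [_ /(_ j)[_ _ _ eS _]] := z_loop t; have [vS _] := z_loop t.
  have -> : Z t.+1 k j = (st_eta (z t.+1) j - v t.+1) k 0 by rewrite [LHS]mxE.
  suff -> : st_eta (z t.+1) j - v t.+1 =
      S *m col j (Z t - mu2 *: (Z t *m (Hmx a)^T)) +
      T t j *m col j (Z t - mu2 *: (Z t *m (Hmx a)^T)) + T t j *m v t.
    rewrite !mxE; congr (_ + _ + _).
    by apply: eq_bigr => m _; rewrite !mxE.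
  have -> : col j (Z t - mu2 *: (Z t *m (Hmx a)^T)) =
      st_eta (z t) j - v t + mu2 *: consensus a (v t) (st_eta (z t)) j.
    rewrite (consensusE a_adj); apply/colP => m; rewrite !mxE summxE.
    congr (_ + _); rewrite -mulrN; congr (_ * - _).
    by apply: eq_bigr => n _; rewrite !mxE mulrC.
  rewrite eS vS /T -mulmxDl [S + _]addrC subrK mulmxDr mulmxBr mulmxBl -scalemxAr.
  by rewrite [X in _ = X + _]addrAC addrA subrK.
apply/exp_decay_entryP => k l; rewrite (ord1 l).
by have := Zd (mxtens_index (i, k)) 0; under eq_fun do rewrite vecE mxE.
Qed.

(** * Tracking by a single follower *)

Variables (i : 'I_N) (X : 'M[R]_(dimx (F i), q)) (U : 'M[R]_(dimu (F i), q)).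
Hypothesis XU_reg : regulator_equations S X U.
Local Notation zs := (vec (col_mx X U)).

(** Since Q zs = b, the residual at the error e is G e + (G - Q) zs. Replacing G^T G by Q^T Q costs
    [D], and both corrections carry a decaying factor G - Q. *)
Lemma zeta_error_decay :
  schur (1%:M - mu3 i *: ((Qmx (F i) S)^T *m Qmx (F i) S)) ->
  exp_decay (fun t => st_zeta (z t) i - zs).
Proof.
set Q := Qmx (F i) S => QQ_schur; pose G t := Gmx (z t) i.
have Gd : exp_decay (fun t => G t - Q).
  apply/exp_decay_entryP => k l.
  case: (mxtens_indexP k) => k1 k2; case: (mxtens_indexP l) => l1 l2.
  pose J := block_mx (1%:M : 'M[R]_(dimx (F i))) 0 0 (0 : 'M[R]_(dimu (F i))).
  have GQ t : G t - Q = (st_S (z t) i - S)^T *t J.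
    rewrite /G /Gmx /Q /Qmx opprB addrA subrK -/J.
    by apply/matrixP => m n; rewrite !mxE mulrBl.
  have /exp_decay_entryP/(_ l1 k1)/(exp_decayZ (J k2 l2)) := S_decay i.
  congr exp_decay; apply/funext => t.
  by rewrite GQ tensmxE scale_scalar_mx mulrC [(_ - S)^T _ _]mxE.
have Qzs : Q *m zs = bvec (F i) by exact/regulator_equationsE.
clearbody Q; have GTb : subexp (fun t => (G t)^T).
  apply: norm_bounded_subexp.
  have [C GC] := norm_boundedD (exp_decay_bounded Gd) (norm_bounded_cst Q).
  by exists C => t; have := GC t; rewrite subrK mx_norm_trmx.
pose D t := (G t)^T *m (G t - Q) + (G t - Q)^T *m Q.
have Dd : exp_decay D.
  apply: exp_decayD; first exact: subexp_mulmx.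
  apply: exp_decay_mulmx; first exact: exp_decay_trmx.
  exact/norm_bounded_subexp/norm_bounded_cst.
have fd : exp_decay (fun t => (G t)^T *m (G t - Q) *m zs).
  apply: exp_decay_mulmx; first exact: subexp_mulmx.
  exact/norm_bounded_subexp/norm_bounded_cst.
apply: (schur_perturbed_decay QQ_schur (exp_decayZ (- mu3 i) Dd)
  (exp_decayZ (- mu3 i) fd)) => t.
have [_ /(_ i)[_ _ _ _ ->]] := z_loop t; rewrite -/(G t).
have -> : G t *m st_zeta (z t) i - bvec (F i) =
    G t *m (st_zeta (z t) i - zs) + (G t - Q) *m zs.
  rewrite -Qzs.
  by move: (G t) => M; rewrite mulmxBr mulmxBl addrA subrK.
set e := st_zeta (z t) i - zs.
have -> : D t = (G t)^T *m G t - Q^T *m Q.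
  by rewrite /D; move: (G t) => M; rewrite [(M - Q)^T]linearB /= mulmxBr mulmxBl addrA subrK.
have -> : st_zeta (z t) i = zs + e by rewrite addrC subrK.
rewrite !scaleNr; move: (G t) => M.
rewrite !(mulmxDl, mulmxDr, mulNmx, mul1mx, scalerDr, opprD, mulmxA, opprK, scalerN).
rewrite -!scalemxAl.
by apply/colP => k; rewrite !mxE; ring.
Qed.

Hypothesis zeta_decay : exp_decay (fun t => st_zeta (z t) i - zs).

Lemma Xhat_error_decay : exp_decay (fun t => Xhat (z t) i - X).
Proof.
apply/exp_decay_entryP => k l.
have /exp_decay_entryP/(_ (mxtens_index (l, lshift _ k)) 0) := zeta_decay.
congr exp_decay; apply/funext => t.
by congr (_%:M); rewrite [LHS]mxE [X in _ + X]mxE vecE col_mxEu !mxE.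
Qed.

Lemma Uhat_error_decay : exp_decay (fun t => Uhat (z t) i - U).
Proof.
apply/exp_decay_entryP => k l.
have /exp_decay_entryP/(_ (mxtens_index (l, rshift _ k)) 0) := zeta_decay.
congr exp_decay; apply/funext => t.
by congr (_%:M); rewrite [LHS]mxE [X in _ + X]mxE vecE col_mxEd !mxE.
Qed.

Hypothesis eta_decay : exp_decay (fun t => st_eta (z t) i - v t).

Lemma feedforward_error_decay :
  exp_decay (fun t => Keta Kx (z t) i *m st_eta (z t) i - (U - Kx i *m X) *m v t).
Proof.
have Kd : exp_decay (fun t => Keta Kx (z t) i - (U - Kx i *m X)).
  have := exp_decayB Uhat_error_decay (exp_decay_mulmxl (Kx i) Xhat_error_decay).
  congr exp_decay; apply/funext => t; rewrite /Keta mulmxBr !opprB.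
  by rewrite [Y in _ = _ + Y]addrC [RHS]addrACA [Y in _ = _ + Y]addrC.
have Kb := norm_boundedD (exp_decay_bounded Kd) (norm_bounded_cst (U - Kx i *m X)).
(* The error splits as K (eta - v) + (K - K') v, with K the current gain and K' its limit; the
   second term uses the subexponential growth of v. *)
have := exp_decayD (subexp_mulmx (norm_bounded_subexp Kb) eta_decay)
  (exp_decay_mulmx Kd v_subexp).
congr exp_decay; apply/funext => t.
move: (Keta _ _ _) (U - _) => K K'.
by rewrite subrK mulmxBr mulmxBl addrA subrK.
Qed.

(** The input enters plant and observer identically and cancels; only eta - v remains as forcing,
    through E + L Fm. *)
Lemma observer_error_decay : schur (fA (F i) + L i *m fCm (F i)) ->
  exp_decay (fun t => st_xi (z t) i - st_x (z t) i).
Proof.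
move=> AL_schur.
apply: (schur_perturbed_decay AL_schur (exp_decay0 _ _ _)
  (exp_decay_mulmxl (fE (F i) + L i *m fFm (F i)) eta_decay)) => t.
have [_ /(_ i)[-> -> _ _ _]] := z_loop t.
rewrite /measurement; set u := input _ _ _; rewrite mul0mx addr0.
rewrite !(mulmxDl, mulmxDr, mulmxN, opprD, mulmxA).
by apply/colP => k; rewrite !mxE; ring.
Qed.

Hypothesis xi_decay : exp_decay (fun t => st_xi (z t) i - st_x (z t) i).

Lemma input_errorE t :
  input Kx (z t) i - U *m v t = Kx i *m (st_x (z t) i - X *m v t) +
    (Kx i *m (st_xi (z t) i - st_x (z t) i) +
     (Keta Kx (z t) i *m st_eta (z t) i - (U - Kx i *m X) *m v t)).
Proof.
rewrite /input !(mulmxDl, mulmxDr, mulmxN, mulNmx, opprD, opprK, mulmxA).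
by apply/colP => k; rewrite !mxE; ring.
Qed.

(** By the first regulator equation X v solves the plant under the input U v, so E v cancels; the
    feedback part of u - U v turns A into A + B Kx. *)
Lemma x_error_decay : schur (fA (F i) + fB (F i) *m Kx i) ->
  exp_decay (fun t => st_x (z t) i - X *m v t).
Proof.
move=> AB_schur.
have wd := exp_decayD (exp_decay_mulmxl (Kx i) xi_decay) feedforward_error_decay.
apply: (schur_perturbed_decay AB_schur (exp_decay0 _ _ _)
  (exp_decay_mulmxl (fB (F i)) wd)) => t.
have [-> /(_ i)[-> _ _ _ _]] := z_loop t; rewrite mul0mx addr0.
rewrite [in RHS]mulmxDl -[in RHS]mulmxA -[RHS]addrA -mulmxDr -input_errorE.
rewrite [X *m (S *m _)]mulmxA (proj1 XU_reg).
rewrite !(mulmxDl, mulmxDr, mulmxN, opprD, mulmxA).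
by apply/colP => k; rewrite !mxE; ring.
Qed.

Hypothesis x_decay : exp_decay (fun t => st_x (z t) i - X *m v t).

Lemma input_error_decay : exp_decay (fun t => input Kx (z t) i - U *m v t).
Proof.
have := exp_decayD (exp_decay_mulmxl (Kx i) x_decay)
  (exp_decayD (exp_decay_mulmxl (Kx i) xi_decay) feedforward_error_decay).
by congr exp_decay; apply/funext => t; rewrite input_errorE.
Qed.

(** The second regulator equation gives F v = - (C X + D U) v, so the output is C (x - X v) + D (u -
    U v). *)
Lemma regulated_output_decay : exp_decay (fun t => regulated_output Kx (z t) i).
Proof.
have := exp_decayD (exp_decay_mulmxl (fC (F i)) x_decay)
  (exp_decay_mulmxl (fD (F i)) input_error_decay).
congr exp_decay; apply/funext => t; rewrite /regulated_output.
have /(congr1 (mulmx^~ (v t))) := proj2 XU_reg.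
rewrite mul0mx !mulmxDl => /esym/eqP; rewrite addrC addr_eq0 => /eqP ->.
by rewrite !mulmxBr !mulmxA opprD addrACA.
Qed.

End TrackingErrors.

Theorem theorem2 (R : realType) (q N : nat)
  (S : 'M[R]_q) (F : 'I_N -> follower R q)
  (E : rel 'I_N.+1) (a : 'M[R]_N.+1)
  (mu1 mu2 : R) (mu3 : 'I_N -> R)
  (Kx : forall i, 'M[R]_(dimu (F i), dimx (F i)))
  (L : forall i, 'M[R]_(dimx (F i), dimy (F i)))
  (a_adj : weighted_adjacency E a)
  (S_eig : forall l, spectrum S l -> Normc.normc l <= 1)
  (AB_stab : forall i, stabilizable (fA (F i)) (fB (F i)))
  (CA_det : forall i, detectable (fCm (F i)) (fA (F i)))
  (reg_eq : forall i,
    exists! XU : 'M[R]_(dimx (F i), q) * 'M[R]_(dimu (F i), q),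
      regulator_equations S XU.1 XU.2)
  (E_tree : spanning_tree_from0 E)
  (mu1_range : 0 < mu1 < 2 / rho (Hmx a))
  (mu2_gt0 : 0 < mu2)
  (mu2_schur : schur ((1%:M : 'M[R]_N) *t S - mu2 *: (Hmx a *t S)))
  (mu3_range : forall i,
    0 < mu3 i < 2 / rho ((Qmx (F i) S)^T *m Qmx (F i) S))
  (Kx_schur : forall i, schur (fA (F i) + fB (F i) *m Kx i))
  (L_schur : forall i, schur (fA (F i) + L i *m fCm (F i)))
  (z0 : state F) :
  (exists z : nat -> state F,
     z 0%N = z0 /\ closed_loop S a mu1 mu2 mu3 Kx L z) /\
  (forall z : nat -> state F,
     z 0%N = z0 -> closed_loop S a mu1 mu2 mu3 Kx L z ->
     (bounded_fun (fun t => st_v (z t)) -> bounded_trajectory z) /\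
     (forall i,
        (fun t => regulated_output Kx (z t) i) @ \oo
          --> (0 : 'cV[R]_(dimu (F i))))).
Proof.
split; first exact: closed_loop_exists.
move=> z _ z_loop.
have v_subexp := leader_subexp z_loop S_eig.
have S_decay := S_error_decay z_loop a_adj
  (schur_gradient_step (Hmx_spectrum_gt0 a_adj E_tree) mu1_range).
have eta_decay := eta_error_decay z_loop v_subexp a_adj S_decay mu2_schur.
have follower_decay i : exists X : 'M[R]_(dimx (F i), q),
    exists Z : 'cV[R]_(q * (dimx (F i) + dimu (F i))),
    [/\ exp_decay (fun t => st_zeta (z t) i - Z),
        exp_decay (fun t => st_xi (z t) i - st_x (z t) i),
        exp_decay (fun t => st_x (z t) i - X *m st_v (z t))
      & exp_decay (fun t => regulated_output Kx (z t) i)].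
  have QQ_schur := schur_gradient_step (gram_spectrum_gt0 (Qmx_unit (reg_eq i)))
    (mu3_range i).
  have [[X U] /= [XU_reg _]] := reg_eq i.
  have zeta_decay := zeta_error_decay z_loop S_decay XU_reg QQ_schur.
  have xi_decay := observer_error_decay z_loop (eta_decay i) (L_schur i).
  have x_decay := x_error_decay z_loop v_subexp XU_reg zeta_decay (eta_decay i)
    xi_decay (Kx_schur i).
  exists X, (vec (col_mx X U)); split=> //.
  exact: (regulated_output_decay Kx v_subexp XU_reg zeta_decay (eta_decay i)
    xi_decay x_decay).
split=> [v_bounded|i]; last first.
  by have [X [Z [_ _ _ e_decay]]] := follower_decay i; exact: exp_decay_cvg0.
split=> // i; have [X [Z [zeta_decay xi_decay x_decay _]]] := follower_decay i.
have /norm_boundedP vb := v_bounded.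
(* Boundedness propagates along the errors: from v to x through X v, from x to xi, from v to eta,
   and from constants to S_i and zeta_i. *)
have bounded_of m n (u w : nat -> 'M[R]_(m, n)) :
    exp_decay (fun t => u t - w t) -> norm_bounded w -> norm_bounded u.
  move=> /exp_decay_bounded ub wb; have [C uC] := norm_boundedD ub wb.
  by exists C => t; have := uC t; rewrite subrK.
have xb : norm_bounded (fun t => st_x (z t) i).
  exact: bounded_of x_decay (norm_bounded_mulmx X vb).
split; apply/norm_boundedP => //.
- exact: bounded_of xi_decay xb.
- exact: bounded_of (S_decay i) (norm_bounded_cst S).
- exact: bounded_of (eta_decay i) vb.
- exact: bounded_of zeta_decay (norm_bounded_cst Z).
Qed.
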